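(* For every positive integer $m$, the orbit Cayley graph $Cay(Z_2^{4m+2},S_2\cup S_3)$ is strongly regular with parameters $$\left(2^{4m+2},\;2^{4m+1}-(-1)^m2^{2m},\;2^{4m}-(-1)^m2^{2m},\;2^{4m}-(-1)^m2^{2m}\right).$$
   Context: $Z_2^n$ is the elementary abelian $2$-group of rank $n$, viewed as the vector space $F_2^n$; here $n=4m+2$. For $v\in Z_2^n$, $|v|$ is the number of coordinates equal to $1$, and $O_i=\{v\in Z_2^n : |v|=i\}$ for $0\le i\le n$. Set $S_0=\bigcup_{i\neq 0,\ i\equiv 0 \,(\mathrm{mod}\ 4)}O_i$ and, for $a\in\{1,2,3\}$, $S_a=\bigcup_{i\equiv a\,(\mathrm{mod}\ 4)}O_i$, with $0\le i\le n$. For a group $G$ and $S\subseteq G$ with $1\notin S$ and $S=S^{-1}$, the Cayley graph $Cay(G,S)$ has vertex set $G$, with $x,y$ adjacent iff $x^{-1}y\in S$; it is called an orbit Cayley graph over $Z_2^n$ if $G=Z_2^n$ and $S$ is a union of some of the $O_i$. A strongly regular graph with parameters $(N,r,\lambda,\mu)$ is a connected $r$-regular graph on $N$ vertices in which any two adjacent vertices have exactly $\lambda$ common neighbours and any two distinct non-adjacent vertices have exactly $\mu$ common neighbours. *)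

(* Defs.v *)
From mathcomp Require Import all_boot all_order all_fingroup all_algebra.

Set Implicit Arguments.
Unset Strict Implicit.
Unset Printing Implicit Defensive.

Import GRing.Theory.
Local Open Scope ring_scope.

Definition simple_graph (V : finType) (e : rel V) : Prop :=
  symmetric e /\ irreflexive e.

Definition common_neighbours (V : finType) (e : rel V) (x y : V) : {set V} :=
  [set z | e x z && e y z].

(* The parameters are integers rather than naturals, so that signed expressions
   such as 2 ^+ k - (-1) ^+ m * 2 ^+ l can be written without truncated
   subtraction; cardinals are compared with them through Posz. *)
Definition strongly_regular (V : finType) (e : rel V) (N r l mu : int) : Prop :=
  [/\ simple_graph e,
      forall x y, connect e x y,
      (#|V|)%:Z = N,
      forall x, (#|[set y | e x y]|)%:Z = r &
      (forall x y, e x y -> (#|common_neighbours e x y|)%:Z = l) /\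
      (forall x y, x != y -> ~~ e x y -> (#|common_neighbours e x y|)%:Z = mu)].

Definition connection_set (gT : finGroupType) (S : {set gT}) : Prop :=
  (1%g \notin S) /\ (S = S^-1)%g.

Definition Cay (gT : finGroupType) (S : {set gT}) : rel gT :=
  fun x y => (x^-1 * y)%g \in S.

(* The group law of this finGroupType is vector addition, so that x^-1 * y in
   group_scope is - x + y. *)
Definition Z2 (n : nat) : finGroupType := 'rV['F_2]_n.

Definition weight (n : nat) (v : 'rV['F_2]_n) : nat :=
  #|[set i : 'I_n | v 0 i == 1]|.

Definition weight_orbit (n i : nat) : {set Z2 n} := [set v | weight v == i].

Definition orbit_union (n : nat) (S : {set Z2 n}) : Prop :=
  exists I : {set 'I_n.+1}, S = \bigcup_(i in I) weight_orbit n i.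

(* The condition 0 < i matters only for a = 0, where it excludes the zero
   vector; it is automatic for a = 1, 2, 3. *)
Definition weight_class (n a : nat) : {set Z2 n} :=
  \bigcup_(i < n.+1 | (0 < i)%N && (i == a %[mod 4])) weight_orbit n i.

(* Main.v *)
Require Import Defs.
From mathcomp Require Import all_boot all_order all_fingroup all_algebra.
From mathcomp Require Import ring zify.

(** Let f be the function on F_2^n that is -1 on S = S_2 \cup S_3 and 1
    elsewhere. Since the binomial coefficient C(w, 2) is odd exactly when w is
    2 or 3 mod 4, f v = (-1)^C(|v|, 2): f is the sign of the quadratic form
    sum_(i < j) v_i v_j.

    Common neighbours in a Cayley graph are counted by the autocorrelations of
    the sign function of its connection set ([Cay_common_neighbours]). Writing
    F for the sum of f over the whole group, if all the autocorrelations
    sum_u f u * f (d + u) with d != 0 vanish (f is a bent function), then any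
    two distinct vertices, adjacent or not, have (2^n - 2 F) / 4 common
    neighbours, and the degree is (2^n - F) / 2. The graph is connected as soon
    as the first number is positive, because distinct vertices are then joined
    by a path of length two ([bent_Cay_strongly_regular]).

    For the f above and n even, the autocorrelations vanish because the polar
    form sum_(i <> j) x_i y_j of that quadratic form is nondegenerate
    ([bin2_sign_autocorrelation]). Finally F is the binomial sum
    sum_k C(n, k) (-1)^C(k, 2), the real part of (1 - i) (1 + i)^n, which is
    (-1)^m 2^(2m+1) for n = 4m + 2 ([binomial_sum_bin2_sign]). *)

Set Implicit Arguments.
Unset Strict Implicit.
Unset Printing Implicit Defensive.

Import Order.TTheory GRing.Theory Num.Theory.
Local Open Scope ring_scope.

(** * Sign functions and Cayley graphs *)

Definition set_sign {T : finType} (S : {set T}) (x : T) : int :=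
  (-1) ^+ (x \in S).

Lemma sum_set_sign (T : finType) (S : {set T}) :
  \sum_x set_sign S x = (#|T|)%:Z - 2 * (#|S|)%:Z.
Proof.
have -> : \sum_x set_sign S x = \sum_(x : T) (1 - 2 * (x \in S)%:Z).
  by apply: eq_bigr => x _; rewrite /set_sign; case: (x \in S).
rewrite sumrB -mulr_sumr sumr_const cardT -cardE.
congr (_ - 2 * _); first by rewrite natz.
rewrite -sum1_card [in RHS]big_mkcond -[RHS]natz natr_sum /=.
by apply: eq_bigr => x _; case: (x \in S).
Qed.

Section CayleyGraphs.
Variables (gT : finGroupType) (S : {set gT}).

Lemma Cay_simple_graph : connection_set S -> simple_graph (Cay S).
Proof.
case=> S1 SV; split=> [x y|x]; rewrite /Cay; last first.
  by rewrite mulVg (negbTE S1).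
by rewrite [in LHS]SV inE invMg invgK.
Qed.

Lemma Cay_degree (x : gT) : #|[set y | Cay S x y]| = #|S|.
Proof.
rewrite -[RHS](card_imset _ (mulgI x)); apply: eq_card => y.
rewrite inE /Cay; apply/idP/imsetP => [Sxy|[s Ss ->]].
  by exists (x^-1 * y)%g; rewrite ?mulKVg.
by rewrite mulKg.
Qed.

(** The indicator of S is (1 - set_sign S) / 2; the product of the indicators
    of u in S and d * u in S, where z = x * u and d = y^-1 * x, is expanded and
    summed over u. The sum of the second linear term is that of the first, by
    translation invariance. *)
Lemma Cay_common_neighbours (x y : gT) :
  4 * (#|common_neighbours (Cay S) x y|)%:Z =
  (#|gT|)%:Z - 2 * (\sum_u set_sign S u)
  + \sum_u set_sign S u * set_sign S (y^-1 * x * u)%g.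
Proof.
have shift (d : gT) : \sum_u set_sign S (d * u)%g = \sum_u set_sign S u.
  by rewrite [RHS](reindex_inj (mulgI d)).
have -> : (#|common_neighbours (Cay S) x y|)%:Z =
   \sum_u ((u \in S) && ((y^-1 * x * u)%g \in S))%:Z.
  rewrite -sum1_card big_mkcond -natz natr_sum (reindex_inj (mulgI x)) /=.
  apply: eq_bigr => u _; rewrite inE /Cay mulKg mulgA.
  by case: (_ && _).
have -> : (#|gT|)%:Z = \sum_(u : gT) 1.
  by rewrite sumr_const cardT -cardE natz.
rewrite [X in _ - X]mulr_natl mulr2n opprD.
rewrite -{2}(shift (y^-1 * x)%g) addrA -!sumrB -big_split /=.
rewrite mulr_sumr; apply: eq_bigr => u _; rewrite /set_sign.
by case: (u \in S); case: (_ \in S).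
Qed.

(** The number of common neighbours of x and y depends on y^-1 * x only through
    its autocorrelation term, hence is the same for all x <> y: this is why
    lambda and mu coincide. *)
Lemma bent_Cay_strongly_regular (r l : int) :
    connection_set S ->
    (forall d : gT, d != 1%g ->
       \sum_u set_sign S u * set_sign S (d * u)%g = 0) ->
    2 * r = (#|gT|)%:Z - \sum_u set_sign S u ->
    4 * l = (#|gT|)%:Z - 2 * (\sum_u set_sign S u) ->
    0 < l ->
  strongly_regular (Cay S) (#|gT|)%:Z r l l.
Proof.
move=> conS bentS r_eq l_eq l_gt0.
have common x y : x != y -> (#|common_neighbours (Cay S) x y|)%:Z = l.
  move=> neq_xy; have d_neq1 : (y^-1 * x)%g != 1%g.
    apply: contra neq_xy => /eqP dE.
    by rewrite -(mulKVg y x) dE mulg1.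
  by apply: (@mulfI _ 4) => //; rewrite Cay_common_neighbours bentS // addr0 l_eq.
have [Csym Cirr] := Cay_simple_graph conS.
split=> //.
- move=> x y; have [->|neq_xy] := eqVneq x y; first exact: connect0.
  have: (0 < #|common_neighbours (Cay S) x y|)%N.
    by rewrite -ltz_nat common.
  case/card_gt0P=> z; rewrite inE => /andP[xz yz].
  by apply: (connect_trans (connect1 xz)); apply: connect1; rewrite Csym.
- move=> x; rewrite Cay_degree; apply: (@mulfI _ 2) => //.
  by rewrite r_eq sum_set_sign; ring.
split=> x y; last by move=> neq_xy _; apply: common.
by move=> xy; apply: common; apply/eqP => xyE; rewrite xyE Cirr in xy.
Qed.

End CayleyGraphs.

(** * The signs of the binomial coefficients C(k, 2) *)

Lemma odd_bin2SS k : odd 'C(k.+2, 2) = ~~ odd 'C(k, 2).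
Proof. by rewrite !binS !bin1 bin0 !oddD /=; case: (odd k); case: (odd _). Qed.

Lemma odd_bin2_mod4 k : odd 'C(k, 2) = (k %% 4 == 2)%N || (k %% 4 == 3)%N.
Proof.
have [q [r [-> r_lt4]]] : exists q r, k = (q * 4 + r)%N /\ (r < 4)%N.
  by exists (k %/ 4)%N, (k %% 4)%N; rewrite -divn_eq ltn_mod.
rewrite modnMDl modn_small //.
elim: q => [|q IHq]; first by case: r r_lt4 => [|[|[|[|]]]].
by rewrite mulSn !addSn !odd_bin2SS negbK.
Qed.

(** Pascal's rule, in the form of the operator identity (1 + E)^(n+1) =
    (1 + E)^n (1 + E) with E the shift of sequences: the sum on the left is the
    value at 0 of (1 + E)^(n+1) g. *)
Lemma binomial_sumS n (g : nat -> int) :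
  \sum_(k < n.+2) 'C(n.+1, k)%:Z * g k =
  \sum_(k < n.+1) 'C(n, k)%:Z * (g k + g k.+1).
Proof.
under [RHS]eq_bigr do rewrite mulrDr.
rewrite big_split /= big_ord_recl [in RHS]big_ord_recl !bin0 -addrA; congr (_ + _).
rewrite (eq_bigr (fun i : 'I_n.+1 =>
  'C(n, i.+1)%:Z * g i.+1 + 'C(n, i)%:Z * g i.+1)); last first.
  by move=> i _; rewrite lift0 binS PoszD mulrDl.
by rewrite big_split /= big_ord_recr /= bin_small // mul0r addr0.
Qed.

Definition bin2_sign (k : nat) : int := (-1) ^+ 'C(k, 2).

Lemma bin2_signS k : bin2_sign k.+1 = (-1) ^+ k * bin2_sign k.
Proof. by rewrite /bin2_sign binS bin1 exprD mulrC. Qed.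

Lemma bin2_signSS k : bin2_sign k.+2 = - bin2_sign k.
Proof. by rewrite /bin2_sign -signr_odd odd_bin2SS signrN signr_odd. Qed.

(** On sequences such that E^2 g = - g, the operator (1 + E)^2 is 2 E, so that
    (1 + E)^4 = 4 E^2 = -4: each step of m multiplies the sum by -4. *)
Lemma binomial_sum_bin2_sign m :
  \sum_(k < (4 * m + 2).+1) 'C(4 * m + 2, k)%:Z * bin2_sign k
  = (-1) ^+ m * 2 ^+ (2 * m).+1.
Proof.
have step2 n (g : nat -> int) : (forall k, g k.+2 = - g k) ->
    \sum_(k < n.+3) 'C(n.+2, k)%:Z * g k
    = 2 * \sum_(k < n.+1) 'C(n, k)%:Z * g k.+1.
  move=> gSS; rewrite binomial_sumS (binomial_sumS n (fun k => g k + g k.+1)).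
  rewrite mulr_sumr; apply: eq_bigr => k _.
  by rewrite gSS; ring.
elim: m => [|m IHm].
  by rewrite step2 ?big_ord1 //; apply: bin2_signSS.
have -> : (4 * m.+1 + 2 = (4 * m + 2).+4)%N by lia.
rewrite (step2 _ bin2_sign bin2_signSS).
rewrite (step2 _ (fun k => bin2_sign k.+1) (fun k => bin2_signSS k.+1)).
under eq_bigr do rewrite bin2_signSS mulrN.
rewrite sumrN IHm; have -> : (2 * m.+1 = (2 * m).+2)%N by lia.
by rewrite !exprS; ring.
Qed.

(** * Weights in F_2^n *)

Section Weight.
Variable n : nat.
Implicit Types x y v : 'rV['F_2]_n.

Lemma weight_lt v : (weight v < n.+1)%N.
Proof. by rewrite ltnS -[n in (_ <= n)%N]card_ord max_card. Qed.

Lemma F2P (a : 'F_2) : a = 0 \/ a = 1.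
Proof. by case: a => [[|[|//]] ?]; [left|right]; apply: val_inj. Qed.

Lemma rV_F2_opp v : - v = v.
Proof.
apply/matrixP => i j; rewrite mxE.
by case: (F2P (v i j)) => ->; [rewrite oppr0 | apply: val_inj].
Qed.

Lemma weightE v : weight v = (\sum_i (v 0%R i == 1%R))%N.
Proof.
rewrite /weight -sum1_card big_mkcond /=.
by apply: eq_bigr => i _; rewrite inE; case: (_ == _).
Qed.

Lemma odd_weightD x y : odd (weight (x + y)) = odd (weight x) (+) odd (weight y).
Proof.
rewrite -oddD !weightE -big_split /= !(big_morph odd oddD (erefl _)).
apply: eq_bigr => i _; rewrite mxE oddD.
by case: (F2P (x 0 i)) => ->; case: (F2P (y 0 i)) => ->.
Qed.

Lemma weight_flip v i :
  weight (v + delta_mx 0 i) =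
  if v 0 i == 1 then (weight v).-1 else (weight v).+1.
Proof.
have split_i w :
    weight w = ((w 0%R i == 1%R) + \sum_(j | j != i) (w 0%R j == 1%R))%N.
  by rewrite weightE (bigD1 i).
rewrite !split_i !mxE !eqxx /=.
rewrite (eq_bigr (fun j => (v 0%R j == 1%R) : nat)); last first.
  by move=> j /negbTE neq_ji; rewrite !mxE neq_ji andbF addr0.
by case: (F2P (v 0 i)) => ->.
Qed.

Lemma bin2_sign_flip v i :
  bin2_sign (weight (v + delta_mx 0 i))
  = (-1) ^+ (odd (weight v) (+) (v 0 i == 1)) * bin2_sign (weight v).
Proof.
rewrite weight_flip; case: eqP => [vi1|_]; last first.
  by rewrite bin2_signS addbF signr_odd.
have : (0 < weight v)%N by rewrite weightE (bigD1 i) //= vi1 eqxx.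
case: (weight v) => //= w _.
by rewrite bin2_signS addbT negbK signr_odd mulrA -exprD -signr_odd oddD addbb mul1r.
Qed.

(** If the coordinates of v all agree with the parity of |v|, then either
    v = 0, or v is the all-ones vector and its weight n is odd. This is the
    nondegeneracy of the bilinear form in even dimension: the pairing of v with
    the i-th unit vector is |v| + v_i mod 2. *)
Lemma exists_flip v : ~~ odd n -> v != 0 ->
  exists i, odd (weight v) (+) (v 0 i == 1).
Proof.
move=> n_even v_neq0; apply/existsP; apply: contraR v_neq0.
rewrite negb_exists => /forallP same; apply/eqP/matrixP => j i.
rewrite ord1 mxE.
have sameE k : (v 0 k == 1) = odd (weight v).
  by have := same k; case: (odd _); case: (_ == _).
have [w_odd|w_even] := boolP (odd (weight v)); last first.
  by have := sameE i; rewrite (negbTE w_even); case: (F2P (v 0 i)) => ->.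
suff wn : weight v = n by rewrite -wn w_odd in n_even.
rewrite weightE (eq_bigr (fun=> 1%N)); first by rewrite sum1_card card_ord.
by move=> k _; rewrite sameE w_odd.
Qed.

(** Translating y by the unit vector of a coordinate i multiplies each term by
    (-1)^(|x| + x_i), which does not depend on y; for i chosen so that this sign
    is -1, the sum equals its own opposite. *)
Lemma bin2_sign_autocorrelation x : ~~ odd n -> x != 0 ->
  \sum_y bin2_sign (weight y) * bin2_sign (weight (x + y)) = 0.
Proof.
move=> n_even /(exists_flip n_even)[i flip_x].
set A := \sum_y _.
suff: A = - A by lia.
rewrite {1}/A (reindex_inj (addIr (delta_mx 0 i))) -sumrN /=.
apply: eq_bigr => y _; rewrite addrA !bin2_sign_flip mulrACA -signr_addb.
rewrite odd_weightD mxE.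
(* The total sign exponent |y| + y_i + |x + y| + (x + y)_i is |x| + x_i
   mod 2. *)
set b := (X in (-1) ^+ X); have -> : b = true; last by rewrite expr1 mulN1r.
rewrite /b; move: flip_x.
case: (F2P (x 0 i)) => ->; case: (F2P (y 0 i)) => -> /=;
  by case: (odd (weight x)); case: (odd (weight y)).
Qed.

Lemma card_weight k : #|[set v : 'rV['F_2]_n | weight v == k]| = 'C(n, k).
Proof.
pose supp v := [set i | v 0 i == 1].
pose ind (A : {set 'I_n}) : 'rV['F_2]_n := \row_i (i \in A)%:R.
have indK : cancel ind supp.
  by move=> A; apply/setP => i; rewrite inE mxE; case: (i \in A).
have suppK : cancel supp ind.
  move=> v; apply/matrixP => j i; rewrite ord1 mxE inE.
  by case: (F2P (v 0 i)) => ->.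
rewrite -[n in RHS]card_ord -card_draws -[RHS](card_imset _ (can_inj indK)).
apply: eq_card => v; rewrite inE; apply/idP/imsetP => [wv|[A]].
  by exists (supp v); rewrite ?inE // suppK.
by rewrite inE => cardA ->; rewrite /weight -/(supp _) indK.
Qed.

Lemma sum_weight (g : nat -> int) :
  \sum_(v : 'rV['F_2]_n) g (weight v) = \sum_(k < n.+1) 'C(n, k)%:Z * g k.
Proof.
rewrite (partition_big (fun v => Ordinal (weight_lt v)) predT) //=.
apply: eq_bigr => k _; rewrite (eq_bigr (fun=> g k)); last first.
  by move=> v /eqP <-.
rewrite sumr_const -card_weight -mulr_natl natz; congr (Posz _ * _).
by apply: eq_card => v; rewrite inE.
Qed.

Lemma mem_weight_class a v :
  (v \in weight_class n a) = (0 < weight v)%N && (weight v == a %[mod 4])%N.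
Proof.
apply/bigcupP/idP => [[i Hi]|Hv].
  by rewrite inE => /eqP->.
by exists (Ordinal (weight_lt v)); rewrite ?inE.
Qed.

Lemma mem_weight_class23 v :
  (v \in weight_class n 2 :|: weight_class n 3) = odd 'C(weight v, 2).
Proof.
rewrite in_setU !mem_weight_class odd_bin2_mod4.
by case: (weight v).
Qed.

End Weight.

(** * The graph Cay(Z_2^(4m+2), S_2 \cup S_3) *)

Theorem corollary4 (m : nat) (m_gt0 : (0 < m)%N) :
  let n := (4 * m + 2)%N in
  let S := weight_class n 2 :|: weight_class n 3 in
  [/\ connection_set S, orbit_union S &
      strongly_regular (Cay S)
        (2 ^+ (4 * m + 2))
        (2 ^+ (4 * m + 1) - (-1) ^+ m * 2 ^+ (2 * m))
        (2 ^+ (4 * m) - (-1) ^+ m * 2 ^+ (2 * m))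
        (2 ^+ (4 * m) - (-1) ^+ m * 2 ^+ (2 * m))].
Proof.
move=> n S.
have signE (v : 'rV['F_2]_n) : set_sign S v = bin2_sign (weight v).
  by rewrite /set_sign mem_weight_class23 signr_odd.
have conS : connection_set S.
  split.
    rewrite mem_weight_class23 weightE big1 // => i _.
    by rewrite mxE.
  by apply/setP => v; rewrite mem_invg (_ : v^-1 = v)%g //; apply: rV_F2_opp.
have orbS : orbit_union S.
  exists [set i : 'I_n.+1 | odd 'C(i, 2)]; apply/setP => v.
  rewrite mem_weight_class23; apply/idP/bigcupP => [Hv|[i]].
    by exists (Ordinal (weight_lt v)); rewrite inE.
  by rewrite !inE => Ci /eqP->.
have sumS : \sum_(v : Z2 n) set_sign S v = (-1) ^+ m * 2 ^+ (2 * m).+1.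
  rewrite -binomial_sum_bin2_sign -sum_weight.
  by apply: eq_bigr => v _; apply: signE.
have cardZ : (#|Z2 n|)%:Z = 2 ^+ (4 * m + 2).
  by rewrite card_mx card_Fp // mul1n -natz natrX.
split=> //; rewrite -cardZ; apply: bent_Cay_strongly_regular => //.
- move=> d d_neq1; rewrite -[RHS](@bin2_sign_autocorrelation n d) //.
    by apply: eq_bigr => u _; rewrite !signE.
  by rewrite /n oddD oddM.
- rewrite cardZ sumS (exprD _ _ 1) (exprD _ _ 2) (exprS _ (2 * m)).
  by move: (2 ^+ (4 * m)) ((-1) ^+ m) (2 ^+ (2 * m)) => a b c; ring.
- rewrite cardZ sumS (exprD _ _ 2) (exprS _ (2 * m)).
  by move: (2 ^+ (4 * m)) ((-1) ^+ m) (2 ^+ (2 * m)) => a b c; ring.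
(* The common value is 2^(2m) (2^(2m) - (-1)^m), and 2^(2m) > 1 as m > 0. *)
have -> : (4 * m = 2 * m + 2 * m)%N by lia.
rewrite exprD -mulrBl mulr_gt0 ?exprn_gt0 // subr_gt0.
apply: (@le_lt_trans _ _ 1).
  by rewrite -signr_odd; case: (odd m).
by rewrite exprn_egt1 // -lt0n muln_gt0.
Qed.
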